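(* Let $\mathcal I\subset\{0,\ldots,N-1\}$ be a selected temporal mode set, and let $P$ be an orthogonal projection on $\mathbb R^d$ with complement $Q:=I-P$. Then, for every history $\mathbf w=(\mathbf w_0,\ldots,\mathbf w_{N-1})\in(\mathbb R^d)^N$, $$\max_{0\le n<N}\|Q\mathbf w_n\|_2\le\frac1{\sqrt N}\left(\operatorname{Tail}_{\mathcal I}(\mathbf w)+\operatorname{Leak}_{\mathcal I}^{P}(\mathbf w)\right).$$
   Context: $N$ is a positive integer and $I$ is the identity. The temporal Fourier coefficients of $\mathbf w\in(\mathbb R^d)^N$ are $\widehat{\mathbf w}_\ell:=\frac1{\sqrt N}\sum_{n=0}^{N-1}\mathbf w_n\exp(-2\pi\imath\ell n/N)\in\mathbb C^d$, $\ell=0,\ldots,N-1$, where $\imath$ is the imaginary unit. An orthogonal projection $P$ on $\mathbb R^d$ is extended complex-linearly to $\mathbb C^d$ by $P(\mathbf a+\imath\mathbf b):=P\mathbf a+\imath P\mathbf b$, and $\|\mathbf a+\imath\mathbf b\|_2^2=\|\mathbf a\|_2^2+\|\mathbf b\|_2^2$ for $\mathbf a,\mathbf b\in\mathbb R^d$. The tail and the selected-mode leak are $$\operatorname{Tail}_{\mathcal I}(\mathbf w):=\sum_{\ell\notin\mathcal I}\|\widehat{\mathbf w}_\ell\|_2,\qquad \operatorname{Leak}_{\mathcal I}^{P}(\mathbf w):=\sum_{\ell\in\mathcal I}\|(I-P)\widehat{\mathbf w}_\ell\|_2,$$ where $\ell\notin\mathcal I$ ranges over $\{0,\ldots,N-1\}\setminus\mathcal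 I$. *)

(* Defs.v *)
From mathcomp Require Import all_boot all_order all_algebra.
From mathcomp Require Import reals sequences exp trigo.
From mathcomp Require Import complex.

Set Implicit Arguments.
Unset Strict Implicit.
Unset Printing Implicit Defensive.

Import Order.TTheory GRing.Theory Num.Theory.

Local Open Scope ring_scope.
Local Open Scope complex_scope.

Definition dotv (R : realType) (d : nat) (u v : 'cV[R]_d) : R :=
  \sum_(i < d) u i 0 * v i 0.

Definition norm2 (R : realType) (d : nat) (u : 'cV[R]_d) : R :=
  Num.sqrt (dotv u u).

Definition Rev (R : realType) (d : nat) (z : 'cV[R[i]]_d) : 'cV[R]_d :=
  map_mx (@complex.Re R) z.

Definition Imv (R : realType) (d : nat) (z : 'cV[R[i]]_d) : 'cV[R]_d :=
  map_mx (@complex.Im R) z.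

Definition cplxv (R : realType) (d : nat) (a b : 'cV[R]_d) : 'cV[R[i]]_d :=
  \col_(i < d) (a i 0 +i* b i 0).

Definition norm2C (R : realType) (d : nat) (z : 'cV[R[i]]_d) : R :=
  Num.sqrt (norm2 (Rev z) ^+ 2 + norm2 (Imv z) ^+ 2).

Definition orthogonal_projection (R : realType) (d : nat)
    (P : {linear 'cV[R]_d -> 'cV[R]_d}) : Prop :=
  (forall x, P (P x) = P x) /\ (forall x y, dotv (P x) y = dotv x (P y)).

(* Complex-linear extension: P (a + i b) = P a + i P b. *)
Definition extC (R : realType) (d : nat) (P : 'cV[R]_d -> 'cV[R]_d)
    (z : 'cV[R[i]]_d) : 'cV[R[i]]_d :=
  cplxv (P (Rev z)) (P (Imv z)).

Definition cexp (R : realType) (z : R[i]) : R[i] :=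
  (expR (complex.Re z))%:C *
  (cos (complex.Im z) +i* sin (complex.Im z)).

Definition fourier (R : realType) (N d : nat) (w : 'I_N -> 'cV[R]_d)
    (l : 'I_N) : 'cV[R[i]]_d :=
  ((Num.sqrt N%:R)^-1 : R)%:C *:
  \sum_(n < N) cexp ((- (2 * pi * l%:R * n%:R / N%:R)) *i) *: cplxv (w n) 0.

Definition Tail (R : realType) (N d : nat) (I : {set 'I_N})
    (w : 'I_N -> 'cV[R]_d) : R :=
  \sum_(l < N | l \notin I) norm2C (fourier w l).

Definition Leak (R : realType) (N d : nat) (I : {set 'I_N})
    (P : 'cV[R]_d -> 'cV[R]_d) (w : 'I_N -> 'cV[R]_d) : R :=
  \sum_(l < N | l \in I) norm2C (fourier w l - extC P (fourier w l)).

(* Main.v *)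
Require Import Defs.
From mathcomp Require Import all_boot all_order all_algebra.
From mathcomp Require Import reals sequences exp trigo.
From mathcomp Require Import complex.
From mathcomp Require Import ring lra.

Set Implicit Arguments.
Unset Strict Implicit.
Unset Printing Implicit Defensive.

Import Order.TTheory GRing.Theory Num.Theory.

Local Open Scope ring_scope.

(** Fourier inversion recovers each time slice from the modes: [w n] is
    [1 / sqrt N] times the sum over [l] of the [l]-th Fourier coefficient,
    rotated by the unimodular factor [exp (2 * pi * i * l * n / N)].  Apply the
    complementary projection [Q x = x - P x].  It passes through the sum and the
    rotations, rotations preserve the length of a complex vector, and the
    triangle inequality leaves [1 / sqrt N] times the sum over all modes of
    the length of [Q] applied to the Fourier coefficient.  On the selected modes
    this sum is the leak.  On the others [Q] is dropped, since an orthogonal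
    projection does not increase length, and what remains is the tail.

    The vector being bounded is real, so only real parts of the rotated
    coefficients have to be summed ([fourier_inversion_Rev]).  Hence
    Cauchy-Schwarz ([dotv_le]) and the triangle inequality are needed for the
    real norm alone, and real linearity of [P] suffices to move [Q] across a
    rotation ([complement_RevZ]).  Inversion itself rests on the vanishing of
    the sum of the powers of a nontrivial root of unity
    ([prim_root_orthogonality]). *)

(** * Euclidean geometry of real column vectors *)

Lemma dotvC (R : realType) d (u v : 'cV[R]_d) : dotv u v = dotv v u.
Proof. by apply: eq_bigr => i _; rewrite mulrC. Qed.

Lemma dotvDl (R : realType) d (u v x : 'cV[R]_d) :
  dotv (u + v) x = dotv u x + dotv v x.
Proof. by rewrite -big_split; apply: eq_bigr => i _; rewrite mxE mulrDl. Qed.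

Lemma dotvZl (R : realType) d (a : R) (u x : 'cV[R]_d) :
  dotv (a *: u) x = a * dotv u x.
Proof. by rewrite mulr_sumr; apply: eq_bigr => i _; rewrite mxE mulrA. Qed.

Lemma dotvDr (R : realType) d (x u v : 'cV[R]_d) :
  dotv x (u + v) = dotv x u + dotv x v.
Proof. by rewrite ![dotv x _]dotvC dotvDl. Qed.

Lemma dotvZr (R : realType) d (a : R) (x u : 'cV[R]_d) :
  dotv x (a *: u) = a * dotv x u.
Proof. by rewrite ![dotv x _]dotvC dotvZl. Qed.

Lemma dotv_ge0 (R : realType) d (u : 'cV[R]_d) : 0 <= dotv u u.
Proof. by apply: sumr_ge0 => i _; rewrite -expr2 sqr_ge0. Qed.

Lemma norm2_ge0 (R : realType) d (u : 'cV[R]_d) : 0 <= norm2 u.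
Proof. exact: sqrtr_ge0. Qed.

Lemma sqr_norm2 (R : realType) d (u : 'cV[R]_d) : norm2 u ^+ 2 = dotv u u.
Proof. by rewrite sqr_sqrtr ?dotv_ge0. Qed.

Lemma norm2Z (R : realType) d (a : R) (u : 'cV[R]_d) :
  norm2 (a *: u) = `|a| * norm2 u.
Proof.
by rewrite /norm2 dotvZl dotvZr mulrA -expr2 sqrtrM ?sqr_ge0 // sqrtr_sqr.
Qed.

Lemma norm2_0 (R : realType) d : norm2 (0 : 'cV[R]_d) = 0.
Proof. by rewrite -(scale0r 0) norm2Z normr0 mul0r. Qed.

Lemma norm2_eq0 (R : realType) d (u : 'cV[R]_d) : (norm2 u == 0) = (u == 0).
Proof.
apply/eqP/eqP => [u0|->]; last exact: norm2_0.
have := sqr_norm2 u; rewrite u0 expr0n /= => /esym uu0.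
apply/colP => i; rewrite mxE; apply/eqP; rewrite -[_ == _]orbb -mulf_eq0.
by rewrite (psumr_eq0P _ uu0) // => j _; rewrite -expr2 sqr_ge0.
Qed.

(** Cauchy-Schwarz. With [a = norm2 u] and [b = norm2 v], the vector
    [b *: u - a *: v] has squared length [2 * (a * b) * (a * b - dotv u v)]. *)
Lemma dotv_le (R : realType) d (u v : 'cV[R]_d) :
  dotv u v <= norm2 u * norm2 v.
Proof.
have [->|u0] := eqVneq u 0; first by rewrite norm2_0 -(scale0r 0) dotvZl !mul0r.
have [->|v0] := eqVneq v 0.
  by rewrite norm2_0 -(scale0r 0) dotvZr mul0r mulr0.
have ab_gt0 : 0 < 2 * (norm2 u * norm2 v).
  by rewrite !mulr_gt0 // lt_neqAle norm2_ge0 eq_sym norm2_eq0 ?u0 ?v0.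
rewrite -subr_ge0 -(pmulr_rge0 _ ab_gt0).
have := dotv_ge0 (norm2 v *: u + (- norm2 u) *: v).
rewrite !(dotvDl, dotvDr, dotvZl, dotvZr) (dotvC v u) -!sqr_norm2.
by congr (0 <= _); ring.
Qed.

Lemma norm2D (R : realType) d (u v : 'cV[R]_d) :
  norm2 (u + v) <= norm2 u + norm2 v.
Proof.
rewrite -(@ler_pXn2r _ 2) ?nnegrE ?addr_ge0 ?norm2_ge0 //.
rewrite sqrrD !sqr_norm2 !(dotvDl, dotvDr) (dotvC v u).
have := dotv_le u v; lra.
Qed.

Lemma norm2_sum (R : realType) d (J : finType) (u : J -> 'cV[R]_d) :
  norm2 (\sum_j u j) <= \sum_j norm2 (u j).
Proof.
apply: (big_ind2 (fun x a => norm2 x <= a)) => // [|x a y b xa yb].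
  by rewrite norm2_0.
exact: le_trans (norm2D x y) (lerD xa yb).
Qed.

(** Pythagoras: [dotv x x] is the sum of the squared lengths of [P x] and of
    [x - P x], because the two are orthogonal. *)
Lemma norm2_complement_le (R : realType) d (P : {linear 'cV[R]_d -> 'cV[R]_d})
    (hP : orthogonal_projection P) (x : 'cV[R]_d) :
  norm2 (x - P x) <= norm2 x.
Proof.
case: hP => PP Psym; rewrite /norm2 ler_wsqrtr //.
have xP : dotv x (P x) = dotv (P x) (P x) by rewrite Psym PP.
rewrite -scaleN1r !(dotvDl, dotvDr, dotvZl, dotvZr) (dotvC (P x) x) xP.
have := dotv_ge0 (P x); lra.
Qed.

(** * Complex vectors through their real and imaginary parts *)

Lemma RevZ (R : realType) d (c : R[i]) (z : 'cV[R[i]]_d) :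
  Rev (c *: z) = complex.Re c *: Rev z - complex.Im c *: Imv z.
Proof. by apply/colP => j; rewrite !mxE; case: c (z j 0) => a b [x y]. Qed.

Lemma ImvZ (R : realType) d (c : R[i]) (z : 'cV[R[i]]_d) :
  Imv (c *: z) = complex.Re c *: Imv z + complex.Im c *: Rev z.
Proof. by apply/colP => j; rewrite !mxE; case: c (z j 0) => a b [x y]. Qed.

Lemma Rev_complement (R : realType) d (P : 'cV[R]_d -> 'cV[R]_d)
    (z : 'cV[R[i]]_d) :
  Rev (z - extC P z) = Rev z - P (Rev z).
Proof. by apply/colP => j; rewrite !mxE raddfB. Qed.

Lemma Imv_complement (R : realType) d (P : 'cV[R]_d -> 'cV[R]_d)
    (z : 'cV[R[i]]_d) :
  Imv (z - extC P z) = Imv z - P (Imv z).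
Proof. by apply/colP => j; rewrite !mxE raddfB. Qed.

Lemma norm2_Rev (R : realType) d (z : 'cV[R[i]]_d) : norm2 (Rev z) <= norm2C z.
Proof.
rewrite -[leLHS]ger0_norm ?norm2_ge0 // -sqrtr_sqr ler_wsqrtr //.
by rewrite lerDl sqr_ge0.
Qed.

(** In the expanded squares the cross terms of the real and of the imaginary
    part cancel. *)
Lemma norm2C_unimodularZ (R : realType) d (c : R[i]) (z : 'cV[R[i]]_d) :
  complex.Re c ^+ 2 + complex.Im c ^+ 2 = 1 -> norm2C (c *: z) = norm2C z.
Proof.
move=> c1; congr Num.sqrt; rewrite RevZ ImvZ !sqr_norm2 -scaleNr.
rewrite !(dotvDl, dotvDr, dotvZl, dotvZr) (dotvC (Imv z)).
rewrite -[RHS]mul1r -c1; ring.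
Qed.

(** The real part of [c *: z] is a real combination of the real and imaginary
    parts of [z] ([RevZ]), and [P] respects real combinations. *)
Lemma complement_RevZ (R : realType) d (P : {linear 'cV[R]_d -> 'cV[R]_d})
    (c : R[i]) (z : 'cV[R[i]]_d) :
  Rev (c *: z) - P (Rev (c *: z)) = Rev (c *: (z - extC P z)).
Proof.
rewrite !RevZ Rev_complement Imv_complement linearB.
rewrite [P (_ *: Rev z)]linearZ [P (_ *: Imv z)]linearZ !scalerBr.
by rewrite !opprD addrACA.
Qed.

Lemma norm2C_complement_le (R : realType) d
    (P : {linear 'cV[R]_d -> 'cV[R]_d}) (hP : orthogonal_projection P)
    (z : 'cV[R[i]]_d) :
  norm2C (z - extC P z) <= norm2C z.
Proof.
rewrite /norm2C Rev_complement Imv_complement ler_wsqrtr //.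
by rewrite lerD // ler_pXn2r ?nnegrE ?norm2_ge0 ?norm2_complement_le.
Qed.

(** * Roots of unity and Fourier inversion *)

Definition cis (R : realType) (t : R) : R[i] := (cos t +i* sin t)%C.

Lemma cexp_imaginary (R : realType) (t : R) : cexp (t *i)%C = cis t.
Proof. by rewrite /cexp /= expR0 mul1r. Qed.

Lemma cis0 (R : realType) : cis (0 : R) = 1.
Proof. by rewrite /cis cos0 sin0. Qed.

Lemma cisD (R : realType) (s t : R) : cis (s + t) = cis s * cis t.
Proof.
apply/eqP; rewrite eq_complex /= sinD cosD.
by apply/andP; split; apply/eqP; ring.
Qed.

Lemma cisN (R : realType) (t : R) : cis (- t) = (cis t)^-1.
Proof. by apply/esym/mulr1_eq; rewrite -cisD subrr cis0. Qed.

Lemma cisMn (R : realType) (t : R) n : cis t ^+ n = cis (t * n%:R).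
Proof.
elim: n => [|n IH]; first by rewrite mulr0 cis0.
by rewrite exprSr IH -cisD -natr1 mulrDr mulr1.
Qed.

(** Since [cos t = 1 - 2 * sin (t / 2) ^+ 2] and [t / 2] lies strictly between
    [0] and [pi], the real part is already less than [1]. *)
Lemma cis_neq1 (R : realType) (t : R) : 0 < t -> t < 2 * pi -> cis t != 1.
Proof.
move=> t_gt0 t_lt; rewrite eq_complex /= negb_and; apply/orP; left.
have s_gt0 : 0 < sin (t / 2) by apply: sin_gt0_pi; rewrite ?divr_gt0 //; lra.
have -> : t = t / 2 + t / 2 by field.
rewrite cosD -!expr2 cos2sin2; have := exprn_gt0 2 s_gt0.
by move=> s2; apply/eqP; lra.
Qed.

Definition unity_root_gen (R : realType) (N : nat) : R[i] :=
  cis (2 * pi / N%:R).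

Lemma unity_root_genX (R : realType) N k :
  unity_root_gen R N ^+ k = cis (2 * pi * k%:R / N%:R).
Proof. by rewrite cisMn mulrAC. Qed.

Lemma prim_unity_root_gen (R : realType) N :
  (0 < N)%N -> N.-primitive_root (unity_root_gen R N).
Proof.
move=> N_gt0; rewrite /primitive_root_of_unity N_gt0; apply/forallP => k.
have N0 : 0 < N%:R :> R by rewrite ltr0n.
rewrite unity_rootE unity_root_genX; apply/eqP.
have [->|kN] := eqVneq k.+1 N.
  by rewrite mulfK ?lt0r_neq0 // /cis mulrC mulr_natr cos2pi sin2pi eqxx.
apply/negbTE/cis_neq1.
  by rewrite divr_gt0 // !mulr_gt0 ?pi_gt0 ?ltr0n.
rewrite ltr_pdivrMr // ltr_pM2l ?mulr_gt0 ?pi_gt0 // ltr_nat ltn_neqAle kN.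
exact: ltn_ord.
Qed.

(** For [n != m] the ratio [q] of the two roots is an [N]-th root of unity other
    than [1], so [(q - 1) * \sum_l q ^+ l = q ^+ N - 1 = 0]. *)
Lemma prim_root_orthogonality (F : fieldType) N (z : F) (n m : 'I_N) :
  N.-primitive_root z ->
  \sum_(l < N) z ^+ (l * n) / z ^+ (l * m) = N%:R *+ (n == m).
Proof.
move=> zN; have zU k : z ^+ k != 0.
  by rewrite expf_neq0 // (prim_root_eq0 zN) -lt0n (prim_order_gt0 zN).
pose q := z ^+ n / z ^+ m.
rewrite (eq_bigr (fun l : 'I_N => q ^+ l)) => [|l _]; last first.
  by rewrite expr_div_n -!exprM ![(l * _)%N]mulnC.
have [nm|nm] := eqVneq n m.
  have -> : q = 1 by rewrite /q nm divff.
  rewrite (eq_bigr (fun=> 1)) => [|l _]; last by rewrite expr1n.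
  by rewrite sumr_const card_ord.
have q1 : q - 1 != 0.
  rewrite subr_eq0; apply: contra nm => /eqP q1.
  rewrite -val_eqE /= -(modn_small (ltn_ord n)) -(modn_small (ltn_ord m)).
  by rewrite -(eq_prim_root_expr zN) -[z ^+ n](divfK (zU m)) -/q q1 mul1r.
apply/eqP; rewrite mulr0n -(mulrI_eq0 _ (mulfI q1)) -subrX1 expr_div_n -!exprM.
by rewrite ![(_ * N)%N]mulnC !exprM (prim_expr_order zN) !expr1n divr1 subrr.
Qed.

Lemma fourierE (R : realType) N d (w : 'I_N -> 'cV[R]_d) (l : 'I_N) :
  fourier w l = ((Num.sqrt N%:R)^-1)%:C%C *:
    \sum_(n < N) (unity_root_gen R N ^+ (l * n))^-1 *: cplxv (w n) 0.
Proof.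
rewrite /fourier; congr (_ *: _); apply: eq_bigr => n _.
by rewrite cexp_imaginary cisN unity_root_genX natrM !mulrA.
Qed.

(** Substituting the definition of the coefficients and exchanging the two
    sums leaves, for each time [m], the orthogonality sum of [n] and [m]: only
    [m = n] survives, with weight [N], which the two factors
    [1 / sqrt N] cancel. *)
Lemma fourier_inversion (R : realType) N d (w : 'I_N -> 'cV[R]_d) (n : 'I_N) :
  cplxv (w n) 0 = ((Num.sqrt N%:R)^-1)%:C%C *:
    \sum_(l < N) unity_root_gen R N ^+ (l * n) *: fourier w l.
Proof.
have N_gt0 : (0 < N)%N by case: n => i; exact: leq_ltn_trans.
under eq_bigr => l _ do rewrite fourierE scalerA mulrC -scalerA scaler_sumr.
rewrite -scaler_sumr scalerA exchange_big /=.
under eq_bigr => m _.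
  under eq_bigr => l _ do rewrite scalerA.
  rewrite -scaler_suml.
  rewrite (prim_root_orthogonality n m (prim_unity_root_gen R N_gt0)).
  over.
rewrite (bigD1 n) //= eqxx big1 ?addr0 => [|m /negbTE]; last first.
  by rewrite eq_sym => ->; rewrite mulr0n scale0r.
rewrite scalerA -rmorphM -expr2 exprVn sqr_sqrtr ?ler0n // fmorphV rmorph_nat.
by rewrite mulVf ?scale1r // pnatr_eq0 -lt0n.
Qed.

Lemma fourier_inversion_Rev (R : realType) N d (w : 'I_N -> 'cV[R]_d)
    (n : 'I_N) :
  w n = (Num.sqrt N%:R)^-1 *:
    \sum_(l < N) Rev (unity_root_gen R N ^+ (l * n) *: fourier w l).
Proof.
have -> : w n = Rev (cplxv (w n) 0) by apply/colP => j; rewrite !mxE.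
rewrite [in LHS]fourier_inversion RevZ /= scale0r subr0.
by congr (_ *: _); rewrite /Rev raddf_sum.
Qed.

(** * The tail-leak bound *)

(* The base value 0 of the iterated maximum is harmless: norms are nonnegative
   and the index set is nonempty since N > 0. *)
Theorem lemma4p3 (R : realType) (N d : nat) (hN : (0 < N)%N)
    (I : {set 'I_N}) (P : {linear 'cV[R]_d -> 'cV[R]_d})
    (hP : orthogonal_projection P) (w : 'I_N -> 'cV[R]_d) :
  \big[Num.max/0]_(n < N) norm2 (w n - P (w n))
    <= (Num.sqrt N%:R)^-1 * (Tail I w + Leak I P w).
Proof.
have sN : 0 <= (Num.sqrt N%:R)^-1 :> R by rewrite invr_ge0 sqrtr_ge0.
apply: (big_ind (fun x => x <= _)) => [|x y xb yb|n _].
- by rewrite mulr_ge0 // addr_ge0 // sumr_ge0 // => l _; exact: sqrtr_ge0.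
- by rewrite ge_max xb.
rewrite (fourier_inversion_Rev w n) [P _]linearZ -scalerBr linear_sum -sumrB.
rewrite norm2Z ger0_norm // ler_wpM2l //; apply: le_trans (norm2_sum _) _.
rewrite (bigID (mem I)) /= addrC.
have mode (l : 'I_N) : norm2 (Rev (unity_root_gen R N ^+ (l * n) *: fourier w l)
    - P (Rev (unity_root_gen R N ^+ (l * n) *: fourier w l)))
    <= norm2C (fourier w l - extC P (fourier w l)).
  rewrite complement_RevZ; apply: le_trans (norm2_Rev _) _.
  by rewrite norm2C_unimodularZ // unity_root_genX /= cos2Dsin2.
apply: lerD; apply: ler_sum => l _; last exact: mode.
exact: le_trans (mode l) (norm2C_complement_le hP _).
Qed.
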